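(* Let $ABC$ be an anticlockwise oriented triangle and let a circle $\Gamma$ with centre $O$ intersect the sides $BC$, $CA$, $AB$ at $\{A_1,A_2\}$, $\{B_1,B_2\}$, $\{C_1,C_2\}$ respectively. Let $P$ and $Q$ be the Miquel points of $\triangle A_1B_1C_1$ and $\triangle A_2B_2C_2$ in $\triangle ABC$, respectively, and put $T_A=PA_1\cap QA_2$, $T_B=PB_1\cap QB_2$, $T_C=PC_1\cap QC_2$. Then $\triangle T_AT_BT_C$ is oppositely (inversely) similar to $\triangle ABC$, with $T_A,T_B,T_C$ corresponding to $A,B,C$ respectively.
   Context: All objects lie in the Euclidean plane. If $D,E,F$ are points on the sidelines $BC,CA,AB$ respectively, the Miquel point of $\triangle DEF$ in $\triangle ABC$ is the common point of the circumcircles of $\triangle AEF$, $\triangle BFD$ and $\triangle CDE$. Two triangles are oppositely similar if an orientation-reversing similarity of the plane maps the vertices of one to the corresponding vertices of the other. The triangle $T_AT_BT_C$ is called the (generalized) first Brocard triangle. In the special case $A_1=B$, $B_1=C$, $C_1=A$, $A_2=C$, $B_2=A$, $C_2=B$ (where $\Gamma$ is the circumcircle of $ABC$, and a circle through two coinciding points is read as the circle tangent there to the corresponding sideline), $P$ and $Q$ are the two Brocard points of $ABC$ and $T_AT_BT_C$ is the classical first Brocard triangle.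
   Formalization: It is additionally assumed that P and Q are distinct: if P = Q then T_A, T_B, T_C all coincide with P and the claim fails, e.g. for an equilateral ABC with Γ its circumcircle in the Brocard labelling. *)

(* Defs.v *)
From Stdlib Require Import Reals.
Open Scope R_scope.

Definition point : Type := (R * R)%type.

Definition dist (X Y : point) : R := dist_euc (fst X) (snd X) (fst Y) (snd Y).

(* Twice the signed area of XYZ is positive. *)
Definition anticlockwise (X Y Z : point) : Prop :=
  0 < (fst Y - fst X) * (snd Z - snd X) - (snd Y - snd X) * (fst Z - fst X).

(* The line UV is only meaningful for U <> V. *)
Definition on_line (U V X : point) : Prop :=
  exists t : R, fst X = fst U + t * (fst V - fst U) /\
                snd X = snd U + t * (snd V - snd U).

Definition on_circle (K : point) (r : R) (X : point) : Prop := dist K X = r.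

(* The circle with centre K and radius r has exactly the points X and Y in
   common with the line UV; X = Y means that the circle touches the line. *)
Definition circle_cuts (K : point) (r : R) (U V X Y : point) : Prop :=
  forall Z : point, (on_line U V Z /\ on_circle K r Z) <-> (Z = X \/ Z = Y).

Definition circle_touches (K : point) (r : R) (U V X : point) : Prop :=
  circle_cuts K r U V X X.

(* P lies on "the circle AEF", where E is on the line CA and F on the line AB.
   If E = A the circle must touch CA at A, and if F = A it must touch AB at A. *)
Definition on_vertex_circle (A B C E F P : point) : Prop :=
  exists (K : point) (r : R),
    0 < r /\
    on_circle K r A /\ on_circle K r E /\ on_circle K r F /\
    (E = A -> circle_touches K r C A A) /\
    (F = A -> circle_touches K r A B A) /\
    on_circle K r P.

Definition miquel_point (A B C D E F P : point) : Prop :=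
  on_line B C D /\ on_line C A E /\ on_line A B F /\
  on_vertex_circle A B C E F P /\
  on_vertex_circle B C A F D P /\
  on_vertex_circle C A B D E P.

(* T is the point of intersection of the lines UV and XY: both lines are
   defined and T is their only common point. *)
Definition meet_at (U V X Y T : point) : Prop :=
  U <> V /\ X <> Y /\
  forall Z : point, (on_line U V Z /\ on_line X Y Z) <-> Z = T.

Definition similarity (f : point -> point) : Prop :=
  exists k : R, 0 < k /\ forall X Y : point, dist (f X) (f Y) = k * dist X Y.

Definition orientation_reversing (f : point -> point) : Prop :=
  forall X Y Z : point, anticlockwise X Y Z -> anticlockwise (f X) (f Z) (f Y).

Definition oppositely_similar (X Y Z X' Y' Z' : point) : Prop :=
  exists f : point -> point,
    similarity f /\ orientation_reversing f /\
    f X = X' /\ f Y = Y' /\ f Z = Z'.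

(* Main.v *)
(** Let u, v, w be the side vectors BC, CA, AB.  The circles through P say that
    PA1, PB1, PC1 make one directed angle with the sidelines, of cotangent k, and
    likewise for Q with cotangent k'.  Adding the three relations gives
    k * (twice the area) = - sum of (A1 - O).u; since O projects to the midpoint
    of A1A2 this yields k' = -k.  Hence TA is the apex of an isosceles triangle on
    A1A2, that is TA - O is orthogonal to u, and the three numbers u x (TA - O)
    add up to 0.  This forces TA, TB, TC to be the projections of one point onto
    the perpendiculars from O to the sidelines, whence they form a triangle
    oppositely similar to ABC; if it degenerates to one point T, then P = Q = T. *)

Require Import Defs.
From Stdlib Require Import Reals Lra Nsatz.
Open Scope R_scope.

(** * Dot and cross products of plane vectors *)

Definition vec (X Y : point) : point := (fst Y - fst X, snd Y - snd X).
Definition dot (u v : point) : R := fst u * fst v + snd u * snd v.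
Definition cross (u v : point) : R := fst u * snd v - snd u * fst v.

Ltac coords := unfold dot, cross, vec in *; simpl in *.

Lemma vec_inj (X Y Z : point) : vec X Y = vec X Z -> Y = Z.
Proof.
  destruct X, Y, Z; coords. intros h; injection h as h1 h2.
  f_equal; lra.
Qed.

Lemma vec_neq (X Y : point) : X <> Y -> vec X Y <> (0, 0).
Proof.
  intros h e; apply h, eq_sym, (vec_inj X). rewrite e.
  unfold vec; f_equal; ring.
Qed.

Lemma dot_self_pos (u : point) : u <> (0, 0) -> 0 < dot u u.
Proof.
  destruct u as [x y]; coords; intros h.
  destruct (Req_dec x 0) as [->|hx]; [destruct (Req_dec y 0) as [->|hy]|].
  - now contradiction h.
  - nra.
  - nra.
Qed.

Lemma dot_cross_zero (u x : point) :
  u <> (0, 0) -> dot x u = 0 -> cross u x = 0 -> x = (0, 0).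
Proof.
  intros hu h1 h2; apply dot_self_pos in hu.
  destruct u as [a b], x as [x y]; coords.
  f_equal; apply (Rmult_eq_reg_l (a * a + b * b)); try lra; rewrite Rmult_0_r.
  - transitivity (a * (x * a + y * b) - b * (a * y - b * x)); [ring|].
    rewrite h1, h2; ring.
  - transitivity (b * (x * a + y * b) + a * (a * y - b * x)); [ring|].
    rewrite h1, h2; ring.
Qed.

(** * Chords of circles, tangency included *)

Lemma dist_sqr (X Y : point) : Defs.dist X Y = sqrt (dot (vec X Y) (vec X Y)).
Proof.
  destruct X, Y; unfold Defs.dist, dist_euc, Rsqr; coords. f_equal; ring.
Qed.

Lemma on_circle_eq (K : point) (r : R) (X Y : point) :
  on_circle K r X -> on_circle K r Y ->
  dot (vec K X) (vec K X) = dot (vec K Y) (vec K Y).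
Proof.
  unfold on_circle; rewrite !dist_sqr; intros <- h.
  apply sqrt_inj; auto; apply Rplus_le_le_0_compat; apply Rle_0_sqr.
Qed.

Lemma on_line_cross (U V X : point) : on_line U V X -> cross (vec U V) (vec U X) = 0.
Proof.
  intros (t & h1 & h2); coords; rewrite h1, h2; ring.
Qed.

Lemma vec_on_line (U V X : point) :
  U <> V -> cross (vec U V) (vec U X) = 0 -> on_line U V X.
Proof.
  intros h hc; pose proof (dot_self_pos _ (vec_neq _ _ h)) as hp.
  set (t := dot (vec U V) (vec U X) / dot (vec U V) (vec U V)).
  assert (ht : t * dot (vec U V) (vec U V) = dot (vec U V) (vec U X))
    by (unfold t; field; lra).
  clearbody t; exists t; coords; split;
    (apply (Rmult_eq_reg_l (dot (vec U V) (vec U V))); [clear h hp; coords; nsatz | coords; lra]).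
Qed.

Lemma dot_dot_parallel (u x s : point) :
  cross u x = 0 -> dot x u * dot s u = dot x s * dot u u.
Proof.
  intros h; transitivity (dot x s * dot u u - cross u x * cross u s);
    [coords; ring | rewrite h; ring].
Qed.

(** The vector KX + KY is orthogonal to XY because [X] and [Y] are equidistant from [K], and XY is
    parallel to [u]. *)
Lemma equidistant_sum (K : point) (r : R) (X Y u : point) :
  on_circle K r X -> on_circle K r Y -> cross u (vec X Y) = 0 ->
  dot (vec X Y) u * (dot (vec K X) u + dot (vec K Y) u) = 0.
Proof.
  intros hX hY hc; pose proof (on_circle_eq _ _ _ _ hX hY) as e.
  transitivity (dot (vec X Y) u *
    dot (fst (vec K X) + fst (vec K Y), snd (vec K X) + snd (vec K Y)) u).
  - coords; ring.
  - rewrite dot_dot_parallel by assumption.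
    apply Rmult_eq_0_compat_r; clear hc; coords; lra.
Qed.

(* The reflection of a common point in the perpendicular through K is again a
   common point. *)
Lemma circle_cuts_midpoint (K : point) (r : R) (U V X Y : point) :
  U <> V -> circle_cuts K r U V X Y ->
  on_line U V X /\ on_line U V Y /\
  dot (vec K X) (vec U V) + dot (vec K Y) (vec U V) = 0.
Proof.
  intros h hc; pose proof (dot_self_pos _ (vec_neq _ _ h)) as hp.
  assert (refl : forall Z, Z = X \/ Z = Y -> exists Z', (Z' = X \/ Z' = Y) /\
      dot (vec K Z') (vec U V) = - dot (vec K Z) (vec U V)).
  { intros Z hZ; apply hc in hZ as [(t & h1 & h2) hZ].
    (* Adding [s] times UV to [Z] reverses the component of KZ along UV and preserves the distance
       to [K]. *)
    set (s := -2 * dot (vec K Z) (vec U V) / dot (vec U V) (vec U V)).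
    assert (hs : s * dot (vec U V) (vec U V) = -2 * dot (vec K Z) (vec U V))
      by (unfold s; field; lra).
    clearbody s.
    exists (fst Z + s * fst (vec U V), snd Z + s * snd (vec U V)); split.
    - apply hc; split.
      + exists (t + s); coords; rewrite h1, h2; split; ring.
      + unfold on_circle in *; rewrite <- hZ, !dist_sqr; f_equal.
        clear h1 h2 hZ; coords.
        apply Rminus_diag_uniq.
        match type of hs with ?l = ?r => transitivity (s * (l - r)) end; [ring|].
        rewrite hs; ring.
    - clear h1 h2 hZ; coords. lra. }
  destruct (proj2 (hc X) (or_introl eq_refl)) as [hX _].
  destruct (proj2 (hc Y) (or_intror eq_refl)) as [hY _].
  do 2 (split; [assumption|]).
  (* If [X] and [Y] are mirror images, the sum vanishes; if each is its own image, both terms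
     vanish. *)
  destruct (refl X (or_introl eq_refl)) as (X' & [-> | ->] & eX); [|lra].
  destruct (refl Y (or_intror eq_refl)) as (Y' & [-> | ->] & eY); lra.
Qed.

(** For distinct points this follows from [equidistant_sum]; that relation is empty when the points
    coincide, and there tangency takes over. *)
Lemma circle_chord (K : point) (r : R) (U V X Y : point) :
  U <> V -> on_circle K r X -> on_circle K r Y ->
  cross (vec U V) (vec X Y) = 0 ->
  (Y = X -> circle_touches K r U V X) ->
  dot (vec K X) (vec U V) + dot (vec K Y) (vec U V) = 0.
Proof.
  intros h hX hY hc ht.
  pose proof (dot_self_pos _ (vec_neq _ _ h)) as hp.
  destruct (Req_dec (dot (vec X Y) (vec U V)) 0) as [e|ne].
  - assert (Y = X) as ->.
    { apply (vec_inj X). rewrite (dot_cross_zero _ _ (vec_neq _ _ h) e hc).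
      unfold vec; f_equal; ring. }
    apply (circle_cuts_midpoint K r U V X X h (ht eq_refl)).
  - destruct (Rmult_integral _ _ (equidistant_sum K r X Y _ hX hY hc)); tauto.
Qed.

Lemma on_circle_on_line (K : point) (r : R) (U V X Y Z : point) :
  U <> V -> on_circle K r X -> on_circle K r Z ->
  cross (vec U V) (vec X Y) = 0 -> cross (vec U V) (vec X Z) = 0 ->
  dot (vec K X) (vec U V) + dot (vec K Y) (vec U V) = 0 ->
  Z = X \/ Z = Y.
Proof.
  intros h hX hZ hY hcZ hs.
  (* By [hs], KX + KZ and YZ have the same component along UV, so this product is the one in
     [equidistant_sum]. *)
  assert (hm : dot (vec X Z) (vec U V) * dot (vec Y Z) (vec U V) = 0).
  { rewrite <- (equidistant_sum K r X Z (vec U V)) by assumption.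
    f_equal; clear - hs; coords; lra. }
  assert (hYZ : cross (vec U V) (vec Y Z) = 0)
    by (clear - hY hcZ; coords; lra).
  apply Rmult_integral in hm as [hm|hm]; [left|right];
    [apply (vec_inj X)|apply (vec_inj Y)];
    rewrite (dot_cross_zero _ _ (vec_neq _ _ h) hm); auto;
    unfold vec; f_equal; ring.
Qed.

(** * Miquel circles and directed angles *)

Lemma on_line_vec_cross (U V X Y : point) :
  on_line U V X -> on_line U V Y -> cross (vec U V) (vec X Y) = 0.
Proof.
  intros hX%on_line_cross hY%on_line_cross; coords; lra.
Qed.

Lemma on_line_left (U V : point) : on_line U V U.
Proof. exists 0; coords; split; ring. Qed.

Lemma on_line_right (U V : point) : on_line U V V.
Proof. exists 1; coords; split; ring. Qed.

(** Puts secant and tangent circles into one linear form: [K] projects to the midpoints of AE and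
    AF. *)
Lemma vertex_circle_chords (A B C E F P : point) :
  C <> A -> A <> B -> on_line C A E -> on_line A B F ->
  on_vertex_circle A B C E F P ->
  exists (K : point) (r : R), on_circle K r A /\ on_circle K r P /\
    dot (vec K A) (vec C A) + dot (vec K E) (vec C A) = 0 /\
    dot (vec K A) (vec A B) + dot (vec K F) (vec A B) = 0.
Proof.
  intros hCA hAB hE hF (K & r & _ & kA & kE & kF & tE & tF & kP).
  exists K, r; do 2 (split; [assumption|]); split.
  - apply (circle_chord K r); auto.
    apply on_line_vec_cross; auto using on_line_right.
  - apply (circle_chord K r); auto.
    apply on_line_vec_cross; auto using on_line_left.
Qed.

(* Equality of the directed angles from PE to v and from PF to w, modulo pi. *)
Lemma concyclic_slope (K A E F P v w : point) (r : R) :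
  on_circle K r A -> on_circle K r P ->
  cross v (vec A E) = 0 -> cross w (vec A F) = 0 ->
  dot (vec K A) v + dot (vec K E) v = 0 ->
  dot (vec K A) w + dot (vec K F) w = 0 ->
  dot (vec E P) v * cross w (vec F P) = dot (vec F P) w * cross v (vec E P).
Proof.
  intros kA kP cE cF hE hF.
  pose proof (on_circle_eq _ _ _ _ kA kP) as e; clear kA kP.
  replace (cross w (vec F P)) with (cross w (vec A P)) by (coords; lra).
  replace (cross v (vec E P)) with (cross v (vec A P)) by (coords; lra).
  replace (dot (vec E P) v) with (dot (vec K P) v + dot (vec K A) v)
    by (coords; lra).
  replace (dot (vec F P) w) with (dot (vec K P) w + dot (vec K A) w)
    by (coords; lra).
  apply Rminus_diag_uniq.
  (* Up to sign, the second factor is the power of [P] with respect to the circle. *)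
  transitivity (cross v w * (dot (vec K A) (vec K A) - dot (vec K P) (vec K P))).
  - coords; ring.
  - rewrite e; ring.
Qed.

Lemma anticlockwise_rot (A B C : point) : anticlockwise A B C -> anticlockwise B C A.
Proof. unfold anticlockwise; lra. Qed.

Lemma anticlockwise_neq (A B C : point) : anticlockwise A B C -> A <> B.
Proof. intros h ->; revert h; unfold anticlockwise; lra. Qed.

Lemma anticlockwise_cross (A B C : point) :
  anticlockwise A B C -> 0 < cross (vec A B) (vec B C).
Proof. unfold anticlockwise; coords; lra. Qed.

(** If [P] were on BC but not at [D], it would be the other point of BC on each of the circles BFD
    and CDE, hence equal to both [B] and [C]. This makes the cotangent at [D] well defined. *)
Lemma miquel_off_side (A B C D E F P : point) :
  anticlockwise A B C -> miquel_point A B C D E F P -> P <> D ->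
  cross (vec B C) (vec D P) <> 0.
Proof.
  intros hABC (hD & hE & hF & _ & hB & hC) hPD h0.
  pose proof (anticlockwise_neq _ _ _ hABC) as nAB.
  pose proof (anticlockwise_neq _ _ _ (anticlockwise_rot _ _ _ hABC)) as nBC.
  pose proof (anticlockwise_neq _ _ _
    (anticlockwise_rot _ _ _ (anticlockwise_rot _ _ _ hABC))) as nCA.
  pose proof (on_line_vec_cross _ _ _ _ (on_line_left B C) hD) as cB.
  pose proof (on_line_vec_cross _ _ _ _ (on_line_right B C) hD) as cC.
  apply vertex_circle_chords in hB as (K & r & kB & kP & _ & s); auto.
  apply vertex_circle_chords in hC as (L & q & lC & lP & t & _); auto.
  assert (P = B) as e1.
  { destruct (on_circle_on_line K r B C B D P); auto; [coords; lra | contradiction]. }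
  assert (P = C) as e2.
  { destruct (on_circle_on_line L q B C C D P); auto; [coords; lra | contradiction]. }
  congruence.
Qed.

Lemma miquel_rot (A B C D E F P : point) :
  miquel_point A B C D E F P -> miquel_point B C A E F D P.
Proof. unfold miquel_point; tauto. Qed.

Lemma miquel_slope (A B C D E F P : point) :
  anticlockwise A B C -> miquel_point A B C D E F P ->
  dot (vec E P) (vec C A) * cross (vec A B) (vec F P) =
  dot (vec F P) (vec A B) * cross (vec C A) (vec E P).
Proof.
  intros hABC (hD & hE & hF & hA & _).
  pose proof (anticlockwise_neq _ _ _ hABC) as nAB.
  pose proof (anticlockwise_neq _ _ _
    (anticlockwise_rot _ _ _ (anticlockwise_rot _ _ _ hABC))) as nCA.
  apply vertex_circle_chords in hA as (K & r & kA & kP & s & t); auto.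
  apply (concyclic_slope K A E F P _ _ r); auto using on_line_vec_cross, on_line_left, on_line_right.
Qed.

(** The cotangent [k] is read off at [D]; the circles through [B] and [C] carry it to [F] and
    [E]. *)
Lemma miquel_cot (A B C D E F P : point) :
  anticlockwise A B C -> miquel_point A B C D E F P ->
  P <> D -> P <> E -> P <> F ->
  exists k : R,
    dot (vec D P) (vec B C) = k * cross (vec B C) (vec D P) /\
    dot (vec E P) (vec C A) = k * cross (vec C A) (vec E P) /\
    dot (vec F P) (vec A B) = k * cross (vec A B) (vec F P).
Proof.
  intros h1 hP nD nE nF.
  pose proof (anticlockwise_rot _ _ _ h1) as h2.
  pose proof (anticlockwise_rot _ _ _ h2) as h3.
  pose proof (miquel_rot _ _ _ _ _ _ _ hP) as hP2.
  pose proof (miquel_rot _ _ _ _ _ _ _ hP2) as hP3.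
  pose proof (miquel_off_side _ _ _ _ _ _ _ h1 hP nD) as cD.
  pose proof (miquel_off_side _ _ _ _ _ _ _ h2 hP2 nE) as cE.
  pose proof (miquel_off_side _ _ _ _ _ _ _ h3 hP3 nF) as cF.
  pose proof (miquel_slope _ _ _ _ _ _ _ h2 hP2) as sFD.
  pose proof (miquel_slope _ _ _ _ _ _ _ h3 hP3) as sDE.
  exists (dot (vec D P) (vec B C) / cross (vec B C) (vec D P)).
  split; [field; assumption|split].
  - apply (Rmult_eq_reg_r (cross (vec B C) (vec D P))); [|assumption].
    rewrite <- sDE; field; assumption.
  - apply (Rmult_eq_reg_r (cross (vec B C) (vec D P))); [|assumption].
    rewrite sFD; field; assumption.
Qed.

(** * Intersections of lines through the two Miquel points *)

Lemma on_line_slope (k : R) (u P D T : point) :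
  on_line P D T -> dot (vec D P) u = k * cross u (vec D P) ->
  dot (vec D T) u = k * cross u (vec D T).
Proof.
  intros (t & h1 & h2) h; transitivity ((1 - t) * dot (vec D P) u);
    [|rewrite h]; clear h; coords; rewrite h1, h2; ring.
Qed.

(* Lines perpendicular to [u] are parallel or equal, so they have no unique
   common point. *)
Lemma meet_not_perp (u P D Q E T : point) :
  u <> (0, 0) -> meet_at P D Q E T ->
  ~ (dot (vec D P) u = 0 /\ dot (vec E Q) u = 0).
Proof.
  intros hu (nPD & nQE & hT) [h1 h2].
  pose proof (dot_self_pos _ hu) as hp.
  destruct (proj2 (hT T) eq_refl) as [T1 T2].
  (* [T] moved along the common direction of the two lines would be a second common point. *)
  set (Z := (fst T + fst (vec P D), snd T + snd (vec P D))).
  assert (Z = T) as e.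
  { apply hT; split; apply vec_on_line; auto.
    - apply on_line_cross in T1; unfold Z; clear - T1; coords; lra.
    - apply on_line_cross in T2.
      assert (hc : cross (vec Q E) (vec P D) = 0).
      { apply (Rmult_eq_reg_l (dot u u)); [|lra].
        clear - h1 h2; coords; nsatz. }
      unfold Z; clear - T2 hc; coords; lra. }
  apply nPD; unfold Z in e; destruct P, D, T; coords; injection e; intros.
  f_equal; lra.
Qed.

(** [D] and [E] see [T] at the same height, so with opposite cotangents DT and ET cancel along [u]:
    [T] projects to the midpoint of DE, as [O] does. *)
Lemma apex_perp (k : R) (u O D E T : point) :
  cross u (vec D E) = 0 -> dot (vec O D) u + dot (vec O E) u = 0 ->
  dot (vec D T) u = k * cross u (vec D T) ->
  dot (vec E T) u = - k * cross u (vec E T) ->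
  dot (vec O T) u = 0 /\ dot (vec O D) u = - k * cross u (vec D T).
Proof.
  intros hc hO hD hE.
  replace (cross u (vec E T)) with (cross u (vec D T)) in hE by (coords; lra).
  assert (hT : dot (vec O T) u = 0).
  { apply (Rmult_eq_reg_l 2); [|lra].
    transitivity (dot (vec O D) u + dot (vec O E) u + dot (vec D T) u + dot (vec E T) u);
      [coords; ring | lra]. }
  split; [exact hT|].
  transitivity (dot (vec O T) u - dot (vec D T) u); [coords; ring | lra].
Qed.

(* Summing the three cotangent relations eliminates P. *)
Lemma cot_sum (k : R) (A B C D E F P O : point) :
  on_line B C D -> on_line C A E -> on_line A B F ->
  dot (vec D P) (vec B C) = k * cross (vec B C) (vec D P) ->
  dot (vec E P) (vec C A) = k * cross (vec C A) (vec E P) ->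
  dot (vec F P) (vec A B) = k * cross (vec A B) (vec F P) ->
  dot (vec O D) (vec B C) + dot (vec O E) (vec C A) + dot (vec O F) (vec A B) =
  - k * cross (vec A B) (vec B C).
Proof.
  intros hD%on_line_cross hE%on_line_cross hF%on_line_cross pD pE pF.
  replace (cross (vec B C) (vec D P)) with (cross (vec B C) (vec B P)) in pD
    by (clear - hD; coords; lra).
  replace (cross (vec C A) (vec E P)) with (cross (vec C A) (vec C P)) in pE
    by (clear - hE; coords; lra).
  replace (cross (vec A B) (vec F P)) with (cross (vec A B) (vec A P)) in pF
    by (clear - hF; coords; lra).
  (* The side vectors add up to zero, so [O] may be replaced by [P]; the cross products then add up
     to twice the area of ABC. *)
  transitivity (- (dot (vec D P) (vec B C) + dot (vec E P) (vec C A) + dot (vec F P) (vec A B)));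
    [|rewrite pD, pE, pF]; clear; coords; ring.
Qed.

(** The signed areas of XBC, XCA, XAB add up to that of ABC; the minus sign comes from vectors that
    start at [X]. *)
Lemma cross_sum (A B C D E F X : point) :
  on_line B C D -> on_line C A E -> on_line A B F ->
  cross (vec B C) (vec X D) + cross (vec C A) (vec X E) + cross (vec A B) (vec X F) =
  - cross (vec A B) (vec B C).
Proof.
  intros hD%on_line_cross hE%on_line_cross hF%on_line_cross; coords; lra.
Qed.

(** * Construction of the opposite similarity *)

Lemma perp_vec (u x : point) :
  u <> (0, 0) -> dot x u = 0 -> exists t : R, x = (- t * snd u, t * fst u).
Proof.
  intros hu h; pose proof (dot_self_pos _ hu) as hp.
  set (t := cross u x / dot u u).
  assert (ht : t * dot u u = cross u x) by (unfold t; field; lra).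
  clearbody t; exists t; destruct u as [a b], x as [x y].
  f_equal; (apply (Rmult_eq_reg_l (dot (a, b) (a, b))); [clear hu hp; coords; nsatz | lra]).
Qed.

(* The map is X |-> A + ((B - A) (TB - TA) / |TB - TA|^2) * conj (X - TA). *)
Lemma oppositely_similar_of_mul (A B C TA TB TC : point) :
  A <> B -> TA <> TB ->
  (let w := vec A B in let c := vec A C in
   let y := vec TA TB in let z := vec TA TC in
   let m := (fst w * fst y - snd w * snd y, fst w * snd y + snd w * fst y) in
   dot w w * fst z = fst m * fst c + snd m * snd c /\
   dot w w * snd z = snd m * fst c - fst m * snd c) ->
  oppositely_similar TA TB TC A B C.
Proof.
  (* In complex numbers, [h1] and [h2] say that (TC - TA)/(TB - TA) is the conjugate of (C - A)/(B -
     A). *)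
  intros nAB nT [h1 h2]; unfold oppositely_similar, similarity, orientation_reversing, anticlockwise.
  pose proof (dot_self_pos _ (vec_neq _ _ nAB)) as hw.
  pose proof (dot_self_pos _ (vec_neq _ _ nT)) as hy.
  set (w := vec A B) in *; set (y := vec TA TB) in *.
  (* The complex coefficient of the map is p + q i. *)
  set (p := (fst w * fst y - snd w * snd y) / dot y y).
  set (q := (fst w * snd y + snd w * fst y) / dot y y).
  assert (hp : p * dot y y = fst w * fst y - snd w * snd y) by (unfold p; field; lra).
  assert (hq : q * dot y y = fst w * snd y + snd w * fst y) by (unfold q; field; lra).
  clearbody p q.
  assert (hpq : 0 < p * p + q * q).
  { apply (Rmult_lt_reg_r (dot y y)); [exact hy|].
    replace ((p * p + q * q) * dot y y) with (dot w w); [lra|].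
    apply (Rmult_eq_reg_r (dot y y)); [|lra].
    clear h1 h2 nAB nT hw hy; subst w y; coords; nsatz. }
  exists (fun X => (fst A + (p * fst (vec TA X) + q * snd (vec TA X)),
                    snd A + (q * fst (vec TA X) - p * snd (vec TA X)))).
  split; [|split; [|split; [|split]]].
  - exists (sqrt (p * p + q * q)); split; [now apply sqrt_lt_R0|].
    intros X Y; rewrite !dist_sqr, <- sqrt_mult_alt by lra.
    f_equal; clear; coords; ring.
  - intros X Y Z hXYZ; simpl.
    apply (Rmult_lt_0_compat _ _ hpq) in hXYZ.
    eapply Rlt_le_trans; [exact hXYZ|]; right.
    clear; coords; ring.
  - destruct A; clear; coords; f_equal; ring.
  - destruct A, B; f_equal;
      (apply (Rmult_eq_reg_r (dot y y)); [|lra]);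
      clear h1 h2 nAB nT hw hy hpq; subst w y; coords; nsatz.
  - destruct A, C; f_equal;
      (apply (Rmult_eq_reg_r (dot y y)); [|lra]);
      (apply (Rmult_eq_reg_r (dot w w)); [|lra]);
      clear nAB nT hw hy hpq; subst w y; coords; nsatz.
Qed.

Lemma perpendiculars_similar (A B C O TA TB TC : point) :
  anticlockwise A B C ->
  dot (vec O TA) (vec B C) = 0 ->
  dot (vec O TB) (vec C A) = 0 ->
  dot (vec O TC) (vec A B) = 0 ->
  cross (vec B C) (vec O TA) + cross (vec C A) (vec O TB) + cross (vec A B) (vec O TC) = 0 ->
  TA <> TB ->
  oppositely_similar TA TB TC A B C.
Proof.
  intros hABC hA hB hC hs nT.
  pose proof (anticlockwise_neq _ _ _ hABC) as nAB.
  pose proof (anticlockwise_neq _ _ _ (anticlockwise_rot _ _ _ hABC)) as nBC.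
  pose proof (anticlockwise_neq _ _ _
    (anticlockwise_rot _ _ _ (anticlockwise_rot _ _ _ hABC))) as nCA.
  apply oppositely_similar_of_mul; auto.
  apply (perp_vec _ _ (vec_neq _ _ nBC)) in hA as [a ha].
  apply (perp_vec _ _ (vec_neq _ _ nCA)) in hB as [b hb].
  apply (perp_vec _ _ (vec_neq _ _ nAB)) in hC as [c hc].
  (* The condition becomes a |BC|^2 + b |CA|^2 + c |AB|^2 = 0. *)
  rewrite ha, hb, hc in hs.
  replace (vec TA TB) with (fst (vec O TB) - fst (vec O TA), snd (vec O TB) - snd (vec O TA))
    by (clear; coords; f_equal; ring).
  replace (vec TA TC) with (fst (vec O TC) - fst (vec O TA), snd (vec O TC) - snd (vec O TA))
    by (clear; coords; f_equal; ring).
  rewrite ha, hb, hc; clear - hs; destruct A, B, C; coords; split; nsatz.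
Qed.

(** * The degenerate case *)

Lemma perp_both_zero (u v x : point) :
  cross u v <> 0 -> dot x u = 0 -> dot x v = 0 -> x = (0, 0).
Proof.
  intros hc h1 h2; destruct u, v, x; f_equal;
    (apply (Rmult_eq_reg_l _ _ _) with (2 := hc)); clear hc; coords; nsatz.
Qed.

(** A nonzero vector PT would make the same directed angle with [u] and [v], which are not
    parallel. *)
Lemma slope_inj (k : R) (u v D E P T : point) :
  cross u v <> 0 -> on_line P D T -> on_line P E T ->
  dot (vec D P) u = k * cross u (vec D P) ->
  dot (vec E P) v = k * cross v (vec E P) ->
  P = T.
Proof.
  intros hc hD hE pD pE.
  pose proof (on_line_slope _ _ _ _ _ hD pD) as tD.
  pose proof (on_line_slope _ _ _ _ _ hE pE) as tE.
  (* This vector is (1 + k i) TP; the slope relation for TP and [u] says that it is orthogonal to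
     [u], and likewise for [v]. *)
  assert (e : (fst (vec T P) - k * snd (vec T P), snd (vec T P) + k * fst (vec T P)) = (0, 0)).
  { apply (perp_both_zero u v); auto; clear - pD pE tD tE; coords; lra. }
  apply (vec_inj T); injection e as e1 e2; clear - e1 e2.
  assert (h : 0 < 1 + k * k) by nra.
  destruct T, P; coords; f_equal; (apply (Rmult_eq_reg_l (1 + k * k)); [clear h; nsatz | lra]).
Qed.

Theorem proposition4p1
  (A B C O : point) (r : R)
  (A1 A2 B1 B2 C1 C2 P Q TA TB TC : point)
  (hABC : anticlockwise A B C)
  (hr : 0 < r)
  (hA : circle_cuts O r B C A1 A2)
  (hB : circle_cuts O r C A B1 B2)
  (hC : circle_cuts O r A B C1 C2)
  (hP : miquel_point A B C A1 B1 C1 P)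
  (hQ : miquel_point A B C A2 B2 C2 Q)
  (hPQ : P <> Q)
  (hTA : meet_at P A1 Q A2 TA)
  (hTB : meet_at P B1 Q B2 TB)
  (hTC : meet_at P C1 Q C2 TC) :
  oppositely_similar TA TB TC A B C.
Proof.
  pose proof (anticlockwise_neq _ _ _ hABC) as nAB.
  pose proof (anticlockwise_neq _ _ _ (anticlockwise_rot _ _ _ hABC)) as nBC.
  pose proof (anticlockwise_neq _ _ _
    (anticlockwise_rot _ _ _ (anticlockwise_rot _ _ _ hABC))) as nCA.
  pose proof (anticlockwise_cross _ _ _ hABC) as hS.
  apply circle_cuts_midpoint in hA as (lA1 & lA2 & mA); [|assumption].
  apply circle_cuts_midpoint in hB as (lB1 & lB2 & mB); [|assumption].
  apply circle_cuts_midpoint in hC as (lC1 & lC2 & mC); [|assumption].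
  destruct (miquel_cot _ _ _ _ _ _ _ hABC hP (proj1 hTA) (proj1 hTB) (proj1 hTC))
    as (k & pA & pB & pC).
  destruct (miquel_cot _ _ _ _ _ _ _ hABC hQ
    (proj1 (proj2 hTA)) (proj1 (proj2 hTB)) (proj1 (proj2 hTC))) as (k' & qA & qB & qC).
  pose proof (cot_sum _ _ _ _ _ _ _ _ O lA1 lB1 lC1 pA pB pC) as sP.
  pose proof (cot_sum _ _ _ _ _ _ _ _ O lA2 lB2 lC2 qA qB qC) as sQ.
  (* By [mA], [mB], [mC] the left sides of [sP] and [sQ] are opposite. *)
  assert (hk' : k' = - k).
  { apply (Rmult_eq_reg_r (cross (vec A B) (vec B C))); lra. }
  subst k'.
  (* For k = 0 both PA1 and QA2 would be perpendicular to BC. *)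
  assert (hk : k <> 0).
  { intros ->; apply (meet_not_perp _ _ _ _ _ _ (vec_neq _ _ nBC) hTA); lra. }
  destruct hTA as (_ & _ & hTA), hTB as (_ & _ & hTB), hTC as (_ & _ & hTC).
  destruct (proj2 (hTA TA) eq_refl) as [tA1 tA2], (proj2 (hTB TB) eq_refl) as [tB1 tB2],
    (proj2 (hTC TC) eq_refl) as [tC1 tC2].
  destruct (apex_perp k _ O A1 A2 TA (on_line_vec_cross _ _ _ _ lA1 lA2) mA
    (on_line_slope _ _ _ _ _ tA1 pA) (on_line_slope _ _ _ _ _ tA2 qA)) as [dA eA].
  destruct (apex_perp k _ O B1 B2 TB (on_line_vec_cross _ _ _ _ lB1 lB2) mB
    (on_line_slope _ _ _ _ _ tB1 pB) (on_line_slope _ _ _ _ _ tB2 qB)) as [dB eB].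
  destruct (apex_perp k _ O C1 C2 TC (on_line_vec_cross _ _ _ _ lC1 lC2) mC
    (on_line_slope _ _ _ _ _ tC1 pC) (on_line_slope _ _ _ _ _ tC2 qC)) as [dC eC].
  apply (perpendiculars_similar A B C O); auto.
  (* Split OTA as OA1 + A1TA, and so on. The first vectors contribute minus twice the area; the
     second contribute plus twice the area, by [eA], [eB], [eC] and [sP] after cancelling [k]. *)
  - pose proof (cross_sum _ _ _ _ _ _ O lA1 lB1 lC1) as sO.
    assert (sT : cross (vec B C) (vec A1 TA) + cross (vec C A) (vec B1 TB)
               + cross (vec A B) (vec C1 TC) = cross (vec A B) (vec B C)).
    { apply (Rmult_eq_reg_l (- k)); lra. }
    clear - sO sT; coords; lra.
  (* If [TA] and [TB] coincide, [P] and [Q] both lie at that point. *)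
  - intros <-; apply hPQ.
    assert (hc : cross (vec B C) (vec C A) <> 0) by (clear - hS; coords; lra).
    transitivity TA; [|symmetry].
    + exact (slope_inj k _ _ _ _ _ _ hc tA1 tB1 pA pB).
    + exact (slope_inj (- k) _ _ _ _ _ _ hc tA2 tB2 qA qB).
Qed.
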